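(* Let $\Gamma=(A,V,s,t)$ be a directed graph, $R$ a ring with identity, and $F$ an $R$-representation of $\Gamma$. Let $W\Gamma$ be the category of paths in $\Gamma$ and $\widetilde F: W\Gamma\to \mathrm{Mod}_R$ the unique functor extending $F$. Then there is an isomorphism of $R$-modules $$\Phi(\Gamma;F)\cong \operatorname{colim}_1^{W\Gamma}\widetilde F,$$ where $\Phi(\Gamma;F)$ is the $R$-module of flows on $\Gamma$ with coefficients in $F$.
   Context: $\mathrm{Mod}_R$ is the category of left $R$-modules. For a small category $\mathbf C$, $\operatorname{colim}_n^{\mathbf C}:\mathrm{Mod}_R^{\mathbf C}\to \mathrm{Mod}_R$ denotes the $n$-th left derived functor of the (right exact) colimit functor $\operatorname{colim}^{\mathbf C}$ on the category of functors $\mathbf C\to\mathrm{Mod}_R$. A (directed) graph $\Gamma=(A,V,s,t)$ consists of a set $A$ of arrows, a set $V$ of vertices and two functions $s,t:A\to V$ (source and target). There are no finiteness assumptions; loops and multiple arrows are allowed. An $R$-representation $F$ of $\Gamma$ is a family of left $R$-modules $\{F(v)\}_{v\in V}$ together with $R$-homomorphisms $F(\alpha):F(s(\alpha))\to F(t(\alpha))$ for $\alpha\in A$. The category $W\Gamma$ has the elements of $V$ as objects; its morphisms $u\to v$ are words $\alpha_1\alpha_2\cdots\alpha_n$ of arrows with $t(\alpha_1)=v$, $s(\alpha_n)=u$, $s(\alpha_i)=t(\alpha_{i+1})$ for $1\le i\le n-1$, together with the empty path $\mathrm{id}_v$ when $u=v$; composition is concatenation (so $W\Gamma$ is the free category on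 $\Gamma$). The functor $\widetilde F$ is given by $\widetilde F(v)=F(v)$, $\widetilde F(\alpha_1\cdots\alpha_n)=F(\alpha_1)\circ\cdots\circ F(\alpha_n)$, $\widetilde F(\mathrm{id}_v)=\mathrm{id}_{F(v)}$. A flow on $\Gamma$ with coefficients in $F$ is a family $\{f_\gamma\}_{\gamma\in A}$ with $f_\gamma\in F(s(\gamma))$, all but finitely many $f_\gamma$ zero, such that for each $v\in V$ $$\sum_{\gamma\in A,\ s(\gamma)=v} f_\gamma=\sum_{\gamma\in A,\ t(\gamma)=v}F(\gamma)(f_\gamma).$$ $\Phi(\Gamma;F)$ is the $R$-module of all flows, a submodule of $\bigoplus_{\gamma\in A}F(s(\gamma))$. *)

(* Defs.v *)
From HB Require Import structures.
From mathcomp Require Import all_boot all_algebra finmap.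
From mathcomp Require Import mathcomp_extra boolp classical_sets functions.
From mathcomp Require Import cardinality fsbigop.

Set Implicit Arguments.
Unset Strict Implicit.
Unset Printing Implicit Defensive.

Import GRing.Theory.
Local Open Scope classical_set_scope.
Local Open Scope ring_scope.
Local Open Scope quotient_scope.

Section Submodule.
Variables (R : pzRingType) (M : lmodType R).

Record submod (S : submodClosed M) :=
  Submod { submod_val :> M; submod_valP : submod_val \in S }.

HB.instance Definition _ S := [isSub for @submod_val S].
HB.instance Definition _ S := [Choice of submod S by <:].
HB.instance Definition _ S := [SubChoice_isSubLmodule of submod S by <:].

Definition span_pred (G : set M) : pred M :=
  fun x => `[< forall S : submodClosed M, G `<=` [set` S] -> x \in S >].

Lemma span_closed G : GRing.subsemimod_closed (span_pred G).
Proof.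
split; first split.
- by apply/asboolP => S _; exact: rpred0.
- move=> x y /asboolP xG /asboolP yG; apply/asboolP => S GS.
  by apply: rpredD; [exact: xG | exact: yG].
- move=> a x /asboolP xG; apply/asboolP => S GS.
  by apply: rpredZ; exact: xG.
Qed.

Definition span G : submodClosed M := HB.pack_for (submodClosed M)
  (span_pred G) (GRing.isSubmodClosed.Build R M (span_pred G) (span_closed G)).

Lemma span_gen (G : set M) x : G x -> x \in span G.
Proof. by move=> Gx; apply/asboolP => S; exact. Qed.

Section Quotient.
Variable S : submodClosed M.

Definition submod_zmod : zmodClosed M :=
  HB.pack_for (zmodClosed M) (GRing.SubmodClosed.sort S) (GRing.isZmodClosed.Build M (GRing.SubmodClosed.sort S)
    (GRing.subsemimod_closedB (GRing.subsemimodClosedP S))).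

(* MathComp's {ideal_quot _} is an additive group; scaling is added here. *)
Definition quot := {ideal_quot submod_zmod}.
Local Notation Q := quot.

HB.instance Definition _ := GRing.Zmodule.on quot.
HB.instance Definition _ : EqQuotient M _ quot := EqQuotient.on quot.
HB.instance Definition _ : isZmodQuotient M (Quotient.equiv submod_zmod)
  0 -%R +%R quot := ZmodQuotient.on quot.

Definition quot_pi (x : M) : Q := \pi x.

Lemma quotW (P : Q -> Prop) : (forall x, P (quot_pi x)) -> forall q, P q.
Proof. by move=> Px q; rewrite -[q]reprK; exact: Px. Qed.

Lemma quot_piP (x y : M) : reflect (quot_pi x = quot_pi y) (x - y \in S).
Proof.
rewrite -[_ \in S]/(x - y \in submod_zmod) Quotient.idealrBE; exact: eqP.
Qed.

Lemma repr_quot_pi (x : M) : repr (quot_pi x) - x \in S.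
Proof. by apply/quot_piP; exact: reprK. Qed.

Lemma quot_piD x y : quot_pi (x + y) = quot_pi x + quot_pi y.
Proof. exact: raddfD. Qed.

Definition quot_scale (a : R) (q : Q) : Q := quot_pi (a *: repr q).

Lemma quot_scaleE a x : quot_scale a (quot_pi x) = quot_pi (a *: x).
Proof.
by apply/quot_piP; rewrite -scalerBr; apply: rpredZ; exact: repr_quot_pi.
Qed.

Lemma quot_scaleA a b q : quot_scale a (quot_scale b q) = quot_scale (a * b) q.
Proof.
by elim/quotW: q => x; rewrite [quot_scale b _]quot_scaleE !quot_scaleE scalerA.
Qed.

Lemma quot_scale1 : left_id 1 quot_scale.
Proof. by elim/quotW => x; rewrite quot_scaleE scale1r. Qed.

Lemma quot_scaleDr : right_distributive quot_scale +%R.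
Proof.
by move=> a; elim/quotW => x; elim/quotW => y;
  rewrite -quot_piD !quot_scaleE scalerDr quot_piD.
Qed.

Lemma quot_scaleDl q : {morph quot_scale^~ q : a b / a + b}.
Proof.
by elim/quotW: q => x a b; rewrite !quot_scaleE scalerDl quot_piD.
Qed.

HB.instance Definition _ := GRing.Zmodule_isLmodule.Build R Q
  quot_scaleA quot_scale1 quot_scaleDr quot_scaleDl.

Lemma quot_pi_linear : linear quot_pi.
Proof. by move=> a x y; rewrite quot_piD -quot_scaleE. Qed.

HB.instance Definition _ := GRing.isLinear.Build R M Q _ quot_pi quot_pi_linear.

Lemma quot_pi_eq0 x : (quot_pi x == 0) = (x \in S).
Proof.
rewrite -(raddf0 quot_pi); apply/eqP/idP => [/quot_piP|xS]; first by rewrite subr0.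
by apply/quot_piP; rewrite subr0.
Qed.

Section Lift.
Variables (N : lmodType R) (f : {linear M -> N}).
Hypothesis f0 : forall x, x \in S -> f x = 0.

Definition quot_lift_fun (q : Q) : N := f (repr q).

Lemma quot_lift_funE x : quot_lift_fun (quot_pi x) = f x.
Proof.
by apply/eqP; rewrite -subr_eq0 -raddfB; apply/eqP/f0/repr_quot_pi.
Qed.

Lemma quot_lift_linear : linear quot_lift_fun.
Proof.
move=> a; elim/quotW => x; elim/quotW => y.
by rewrite -linearP !quot_lift_funE linearP.
Qed.

HB.instance Definition _ :=
  GRing.isLinear.Build R Q N _ quot_lift_fun quot_lift_linear.

Definition quot_lift : {linear Q -> N} := quot_lift_fun.

Lemma quot_liftE x : quot_lift (quot_pi x) = f x.
Proof. exact: quot_lift_funE. Qed.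

End Lift.
End Quotient.
End Submodule.

Arguments quot_lift {R M S N}.

Section KerIm.
Variables (R : pzRingType) (M N : lmodType R) (f : {linear M -> N}).

Definition ker_pred : pred M := fun x => f x == 0.

Lemma ker_closed : GRing.subsemimod_closed ker_pred.
Proof.
split; first split.
- by apply/eqP; rewrite linear0.
- by move=> x y /eqP fx /eqP fy; apply/eqP; rewrite linearD fx fy addr0.
- by move=> a x /eqP fx; apply/eqP; rewrite linearZ_LR fx scaler0.
Qed.

Definition ker : submodClosed M := HB.pack_for (submodClosed M)
  ker_pred (GRing.isSubmodClosed.Build R M ker_pred ker_closed).

Definition im_pred : pred N := fun y => `[< exists x, f x = y >].

Lemma im_closed : GRing.subsemimod_closed im_pred.
Proof.
split; first split.
- by apply/asboolP; exists 0; rewrite linear0.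
- by move=> _ _ /asboolP[x <-] /asboolP[y <-]; apply/asboolP; exists (x + y); rewrite linearD.
- by move=> a _ /asboolP[x <-]; apply/asboolP; exists (a *: x); rewrite linearZ_LR.
Qed.

Definition im : submodClosed N := HB.pack_for (submodClosed N)
  im_pred (GRing.isSubmodClosed.Build R N im_pred im_closed).

Lemma kerP x : reflect (f x = 0) (x \in ker).
Proof. exact: eqP. Qed.

Lemma imP y : reflect (exists x, f x = y) (y \in im).
Proof. exact: asboolP. Qed.

End KerIm.

Section DirectSum.
Variables (R : pzRingType) (I : Type) (M : I -> lmodType R).

(* The element of M j corresponding to x : M i when i = j, and 0 otherwise. *)
Definition cast_or0 (i j : I) (x : M i) : M j :=
  if pselect (i = j) is left e then eq_rect i (fun k => M k : Type) x j e else 0.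

Lemma cast_or0_linear i j : linear (@cast_or0 i j).
Proof.
rewrite /cast_or0; case: pselect => [e|_] a x y; last by rewrite scaler0 addr0.
by case: _ / e.
Qed.

HB.instance Definition _ i j :=
  GRing.isLinear.Build R (M i) (M j) _ (@cast_or0 i j) (@cast_or0_linear i j).

Lemma cast_or0_id i (x : M i) : cast_or0 i x = x.
Proof. by rewrite /cast_or0; case: pselect => // e; rewrite (Prop_irrelevance e erefl). Qed.

Lemma cast_or0_neq i j (x : M i) : i <> j -> cast_or0 j x = 0.
Proof. by rewrite /cast_or0; case: pselect. Qed.

Record dsum := Dsum {
  dsum_fun :> forall i, M i;
  dsum_finite : finite_set [set i | dsum_fun i != 0] }.

HB.instance Definition _ := gen_eqMixin dsum.
HB.instance Definition _ := gen_choiceMixin dsum.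

Lemma dsumP (x y : dsum) : (forall i, x i = y i) -> x = y.
Proof.
case: x y => [x xf] [y yf] /= xy; have {}xy : x = y by apply: functional_extensionality_dep.
by case: _ / xy in yf *; congr Dsum; exact: Prop_irrelevance.
Qed.

Lemma dsum0_finite : finite_set [set i | (0 : M i) != 0].
Proof. by rewrite (_ : mkset _ = set0)// -subset0 => i /=; rewrite eqxx. Qed.

Lemma dsumD_finite (x y : dsum) : finite_set [set i | x i + y i != 0].
Proof.
apply: (@sub_finite_set _ _ ([set i | x i != 0] `|` [set i | y i != 0])).
  move=> i /=; case: (eqVneq (x i) 0) => [->|]; last by left.
  by rewrite add0r; right.
by rewrite finite_setU; split; exact: dsum_finite.
Qed.

Lemma dsumZ_finite a (x : dsum) : finite_set [set i | a *: x i != 0].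
Proof.
apply: (sub_finite_set _ (dsum_finite x)) => i /=.
by apply: contra_neq => ->; rewrite scaler0.
Qed.

Lemma dsumN_finite (x : dsum) : finite_set [set i | - x i != 0].
Proof. by apply: (sub_finite_set _ (dsum_finite x)) => i /=; rewrite oppr_eq0. Qed.

Let add x y := Dsum (dsumD_finite x y).
Let opp x := Dsum (dsumN_finite x).
Let scale a x := Dsum (dsumZ_finite a x).

Let addA : associative add.
Proof. by move=> x y z; apply: dsumP => i /=; rewrite addrA. Qed.
Let addC : commutative add.
Proof. by move=> x y; apply: dsumP => i /=; rewrite addrC. Qed.
Let add0 : left_id (Dsum dsum0_finite) add.
Proof. by move=> x; apply: dsumP => i /=; rewrite add0r. Qed.
Let addN : left_inverse (Dsum dsum0_finite) opp add.
Proof. by move=> x; apply: dsumP => i /=; rewrite addNr. Qed.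

HB.instance Definition _ := GRing.isZmodule.Build dsum addA addC add0 addN.

Let scaleA a b x : scale a (scale b x) = scale (a * b) x.
Proof. by apply: dsumP => i /=; rewrite scalerA. Qed.
Let scale1 : left_id 1 scale.
Proof. by move=> x; apply: dsumP => i /=; rewrite scale1r. Qed.
Let scaleDr : right_distributive scale +%R.
Proof. by move=> a x y; apply: dsumP => i /=; rewrite scalerDr. Qed.
Let scaleDl x : {morph scale^~ x : a b / a + b}.
Proof. by move=> a b; apply: dsumP => i /=; rewrite scalerDl. Qed.

HB.instance Definition _ :=
  GRing.Zmodule_isLmodule.Build R dsum scaleA scale1 scaleDr scaleDl.

Lemma dsum_in_finite i (y : M i) : finite_set [set j | cast_or0 j y != 0].
Proof.
apply: (@sub_finite_set _ _ [set i]); last exact: finite_set1.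
by move=> j /=; apply: contra_neqP => /nesym ij; rewrite cast_or0_neq.
Qed.

Definition dsum_in_fun i (y : M i) : dsum := Dsum (dsum_in_finite y).

Lemma dsum_in_linear i : linear (@dsum_in_fun i).
Proof. by move=> a x y; apply: dsumP => j; rewrite /= linearP. Qed.

HB.instance Definition _ i :=
  GRing.isLinear.Build R (M i) dsum _ (@dsum_in_fun i) (@dsum_in_linear i).

Definition dsum_in i : {linear M i -> dsum} := @dsum_in_fun i.

Definition dsum_proj i (x : dsum) : M i := x i.

Lemma dsum_proj_linear i : linear (dsum_proj i).
Proof. by []. Qed.

HB.instance Definition _ i :=
  GRing.isLinear.Build R dsum (M i) _ (dsum_proj i) (@dsum_proj_linear i).

Lemma dsum_decomp (x : dsum) :
  x = \sum_(i \in [set: {classic I}]) dsum_in i (x i).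
Proof.
have xf : finite_set [set i : {classic I} | x i != 0] by exact: dsum_finite.
rewrite (fsbigTE (fset_set [set i : {classic I} | x i != 0])); last first.
  move=> i; rewrite in_fset_set// notin_setE/= => /negP; rewrite negbK => /eqP ->.
  by rewrite raddf0.
apply: dsumP => j; rewrite -[RHS]/(dsum_proj j _) raddf_sum.
rewrite /dsum_proj /=.
have [xj0|xj0] := eqVneq (x j) 0.
  rewrite xj0 big1// => i _; have [->|ij] := pselect (i = j).
    by rewrite cast_or0_id xj0.
  by rewrite cast_or0_neq.
have jS : (j : {classic I}) \in fset_set [set i : {classic I} | x i != 0].
  by rewrite in_fset_set// inE.
rewrite (bigD1_seq _ jS (fset_uniq _)) /=.
by rewrite cast_or0_id big1 ?addr0// => i /eqP ij; rewrite cast_or0_neq.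
Qed.

Lemma dsum_ext (N : lmodType R) (f g : {linear dsum -> N}) :
  (forall i (y : M i), f (dsum_in i y) = g (dsum_in i y)) -> f =1 g.
Proof.
move=> fg x; rewrite [x]dsum_decomp !raddf_sum.
by apply: eq_bigr => i _; exact: fg.
Qed.

Section Sum.
Variables (N : lmodType R) (D : set {classic I}) (f : forall i, {linear M i -> N}).

Definition dsum_sum (x : dsum) : N := \sum_(i \in D) f i (x i).

Lemma dsum_sumE (A : {fset {classic I}}) (x : dsum) :
    (forall i, i \notin A -> x i = 0) ->
  dsum_sum x = \sum_(i <- A | i \in D) f i (x i).
Proof.
move=> xA; rewrite /dsum_sum fsbig_mkcond (fsbigTE A); first by rewrite [RHS]big_mkcond.
by move=> i iA; rewrite /patch xA// raddf0; case: ifP.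
Qed.

Lemma dsum_supp (x : dsum) (i : {classic I}) :
  i \notin fset_set [set i : {classic I} | x i != 0] -> x i = 0.
Proof.
have xf : finite_set [set i : {classic I} | x i != 0] by exact: dsum_finite.
by rewrite in_fset_set// notin_setE/= => /negP; rewrite negbK => /eqP.
Qed.

Lemma dsum_sum_linear : linear dsum_sum.
Proof.
move=> a x y; pose S (z : dsum) := fset_set [set i : {classic I} | z i != 0].
have SxP i : i \notin (S x `|` S y)%fset -> x i = 0.
  by rewrite inE negb_or => /andP[/dsum_supp ? _].
have SyP i : i \notin (S x `|` S y)%fset -> y i = 0.
  by rewrite inE negb_or => /andP[_ /dsum_supp].
rewrite !(@dsum_sumE (S x `|` S y)%fset)//; last first.
  by move=> i iS; rewrite /= SxP// SyP// scaler0 addr0.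
by rewrite scaler_sumr -big_split; apply: eq_bigr => i _; rewrite /= linearP.
Qed.

HB.instance Definition _ :=
  GRing.isLinear.Build R dsum N _ dsum_sum dsum_sum_linear.

End Sum.

Definition dsum_rec (N : lmodType R) (f : forall i, {linear M i -> N}) :
  {linear dsum -> N} := dsum_sum setT f.

Lemma dsum_recE (N : lmodType R) (f : forall i, {linear M i -> N}) i (y : M i) :
  dsum_rec f (dsum_in i y) = f i y.
Proof.
rewrite /dsum_rec /= (@dsum_sumE _ _ _ [fset (i : {classic I})]%fset).
  by rewrite big_mkcond big_seq_fset1 in_setT /= cast_or0_id.
by move=> j; rewrite inE => /eqP ji; rewrite /= cast_or0_neq//; exact: nesym.
Qed.

End DirectSum.

Arguments cast_or0 {R I M i} j x.
Arguments dsum_in {R I} M i.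

Record category := Category {
  obj :> Type;
  hom : obj -> obj -> Type;
  idm : forall a, hom a a;
  compm : forall a b c, hom b c -> hom a b -> hom a c;
  comp1m : forall a b (f : hom a b), compm (idm b) f = f;
  compm1 : forall a b (f : hom a b), compm f (idm a) = f;
  compmA : forall a b c d (h : hom c d) (g : hom b c) (f : hom a b),
    compm h (compm g f) = compm (compm h g) f }.

Arguments idm {_} a.
Arguments compm {_ a b c} g f : rename.

Section Functors.
Variables (R : pzRingType) (C : category).

Record functor := Functor {
  fobj :> C -> lmodType R;
  fmap : forall a b, hom a b -> {linear fobj a -> fobj b};
  fmap1 : forall a (x : fobj a), fmap (idm a) x = x;
  fmapM : forall a b c (g : hom b c) (f : hom a b) (x : fobj a),
    fmap (compm g f) x = fmap g (fmap f x) }.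

Record nat_trans (F G : functor) := NatTrans {
  nt :> forall a, {linear F a -> G a};
  nt_natural : forall a b (f : hom a b) (x : F a),
    nt b (fmap F f x) = fmap G f (nt a x) }.

Definition epi (F G : functor) (e : nat_trans F G) : Prop :=
  forall (H : functor) (g h : nat_trans G H),
    (forall a x, g a (e a x) = h a (e a x)) -> forall a y, g a y = h a y.

Definition projective (P : functor) : Prop :=
  forall (F G : functor) (e : nat_trans F G) (g : nat_trans P G), epi e ->
    exists h : nat_trans P F, forall a x, e a (h a x) = g a x.

(* Kernels and images in the functor category are computed objectwise. *)
Definition exact_at (F G H : functor) (f : nat_trans F G) (g : nat_trans G H) :
  Prop := forall a, im (f a) =i ker (g a).

(* An exact complex ... -> P_1 -> P_0 -> F -> 0 with every P_n projective. *)
Record proj_resolution (F : functor) := ProjResolution {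
  res :> nat -> functor;
  res_d : forall n, nat_trans (res n.+1) (res n);
  res_aug : nat_trans (res 0) F;
  res_projective : forall n, projective (res n);
  res_exact : forall n, exact_at (res_d n.+1) (res_d n);
  res_exact0 : exact_at (res_d 0) res_aug;
  res_epi : epi res_aug }.

End Functors.

Arguments fmap {R C} f {a b} : rename.

Section EpiSurjective.
Variables (R : pzRingType) (C : category) (F G : functor R C).
Variable e : nat_trans F G.

Definition coker_obj a : lmodType R := quot (im (e a)).

Lemma coker_fmap_subproof a b (f : hom a b) y :
  y \in im (e a) -> (@quot_pi _ _ (im (e b)) \o fmap G f) y = 0.
Proof.
move=> /imP[x <-]; apply/eqP; rewrite /= -nt_natural quot_pi_eq0.
by apply/imP; exists (fmap F f x).
Qed.

Definition coker_fmap a b (f : hom a b) : {linear coker_obj a -> coker_obj b} :=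
  quot_lift _ (@coker_fmap_subproof a b f).

Lemma coker_fmapE a b (f : hom a b) y :
  coker_fmap f (quot_pi (im (e a)) y) = quot_pi (im (e b)) (fmap G f y).
Proof. exact: quot_liftE. Qed.

Lemma coker_fmap1 a q : coker_fmap (idm a) q = q.
Proof. by elim/quotW: q => y; rewrite coker_fmapE fmap1. Qed.

Lemma coker_fmapM a b c (g : hom b c) (f : hom a b) q :
  coker_fmap (compm g f) q = coker_fmap g (coker_fmap f q).
Proof.
by elim/quotW: q => y; rewrite [coker_fmap f _]coker_fmapE !coker_fmapE fmapM.
Qed.

Definition coker : functor R C := Functor coker_fmap1 coker_fmapM.

Definition coker_pi : nat_trans G coker :=
  @NatTrans R C G coker (fun a => @quot_pi _ _ (im (e a)))
    (fun a b f y => esym (@coker_fmapE a b f y)).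

Lemma coker_zero_natural a b (f : hom a b) (y : G a) :
  (\0 : {linear G b -> coker b}) (fmap G f y) =
  fmap coker f ((\0 : {linear G a -> coker a}) y).
Proof. exact: esym (linear0 (coker_fmap f)). Qed.

Definition coker_zero : nat_trans G coker :=
  @NatTrans R C G coker (fun a => \0) coker_zero_natural.

Lemma epi_surj : epi e -> forall a y, exists x, e a x = y.
Proof.
move=> ee a y; apply/imP; rewrite -quot_pi_eq0; apply/eqP.
have := ee coker coker_pi coker_zero _ a y; apply=> {y}b x /=.
by apply/eqP; rewrite quot_pi_eq0; apply/imP; exists x.
Qed.

End EpiSurjective.

Lemma surj_epi (R : pzRingType) (C : category) (F G : functor R C)
  (e : nat_trans F G) : (forall a y, exists x, e a x = y) -> epi e.
Proof. by move=> es H g h gh a y; have [x <-] := es a y; exact: gh. Qed.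

Section ScaleBy.
Variables (R : pzRingType) (M : lmodType R) (x : M).

Definition scale_by (r : R^o) : M := (r : R) *: x.

Lemma scale_by_linear : linear scale_by.
Proof. by move=> a r s; rewrite /scale_by scalerDl -scalerA. Qed.

HB.instance Definition _ :=
  GRing.isLinear.Build R R^o M _ scale_by scale_by_linear.

End ScaleBy.

(* The free functor on a family of sets X : the value at c is the free module on
   the pairs of an element of some X a and a morphism a -> c. *)
Section Free.
Variables (R : pzRingType) (C : category) (X : C -> Type).

Definition free_gen (c : C) := {a : C & (X a * hom a c)%type}.

Definition free_obj (c : C) : lmodType R := dsum (fun _ : free_gen c => R^o).

Definition free_in c a (x : X a) (f : hom a c) : {linear R^o -> free_obj c} :=
  dsum_in (fun _ : free_gen c => R^o) (existT _ a (x, f)).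

Definition free_rec c (N : lmodType R) (h : forall a, X a -> hom a c -> N) :
    {linear free_obj c -> N} :=
  dsum_rec (fun i : free_gen c => scale_by (h _ (projT2 i).1 (projT2 i).2)).

Lemma free_recE c (N : lmodType R) (h : forall a, X a -> hom a c -> N)
  a (x : X a) f r : free_rec h (free_in x f r) = (r : R) *: h a x f.
Proof. by rewrite /free_rec /free_in dsum_recE. Qed.

Lemma free_ext c (N : lmodType R) (g h : {linear free_obj c -> N}) :
  (forall a (x : X a) f, g (free_in x f 1) = h (free_in x f 1)) -> g =1 h.
Proof.
move=> gh; apply: dsum_ext => -[a [x f]] r.
by rewrite -[r]mulr1 -[r * 1]/(r *: (1 : R^o)) !linearZ_LR; congr (_ *: _); exact: gh.
Qed.

Definition free_fmap b c (g : hom b c) : {linear free_obj b -> free_obj c} :=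
  free_rec (fun a x f => free_in x (compm g f) 1).

Lemma free_fmapE b c (g : hom b c) a (x : X a) f :
  free_fmap g (free_in x f 1) = free_in x (compm g f) 1.
Proof. by rewrite /free_fmap free_recE scale1r. Qed.

Lemma free_fmap1 c z : free_fmap (idm c) z = z.
Proof.
apply: (free_ext (h := idfun)) => a x f.
by rewrite free_fmapE comp1m.
Qed.

Lemma free_fmapM a b c (g : hom b c) (f : hom a b) z :
  free_fmap (compm g f) z = free_fmap g (free_fmap f z).
Proof.
apply: (free_ext (h := free_fmap g \o free_fmap f)) => d x k.
rewrite -[RHS]/(free_fmap g (free_fmap f (free_in x k 1))).
by rewrite !free_fmapE compmA.
Qed.

Definition free : functor R C := Functor free_fmap1 free_fmapM.

Section FreeMap.
Variables (G : functor R C) (h : forall a, X a -> G a).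

Definition free_map_fun c : {linear free c -> G c} :=
  free_rec (fun a x f => fmap G f (h x)).

Lemma free_map_funE c a (x : X a) (f : hom a c) :
  free_map_fun c (free_in x f 1) = fmap G f (h x).
Proof. by rewrite /free_map_fun free_recE scale1r. Qed.

Lemma free_map_natural b c (g : hom b c) z :
  free_map_fun c (fmap free g z) = fmap G g (free_map_fun b z).
Proof.
apply: (free_ext (g := free_map_fun c \o free_fmap g)
  (h := fmap G g \o free_map_fun b)) => a x f.
rewrite -[LHS]/(free_map_fun c (free_fmap g (free_in x f 1))).
rewrite -[RHS]/(fmap G g (free_map_fun b (free_in x f 1))).
by rewrite free_fmapE !free_map_funE fmapM.
Qed.

Definition free_map : nat_trans free G := NatTrans free_map_natural.

Lemma free_mapE c a (x : X a) (f : hom a c) :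
  free_map c (free_in x f 1) = fmap G f (h x).
Proof. exact: free_map_funE. Qed.

End FreeMap.

Lemma free_projective : projective free.
Proof.
move=> F G e g /epi_surj es.
pose h a (x : X a) : F a := projT1 (cid (es a (g a (free_in x (idm a) 1)))).
have hE a x : e a (h a x) = g a (free_in x (idm a) 1).
  by rewrite /h; case: cid.
exists (free_map h) => c z.
apply: (free_ext (g := e c \o free_map h c) (h := g c)) => a x f.
rewrite -[LHS]/(e c (free_map h c (free_in x f 1))) free_mapE nt_natural hE.
rewrite -nt_natural; congr (g c _).
by rewrite [LHS]free_fmapE compm1.
Qed.

End Free.

Arguments free R {C} X.
Arguments free_in R {C X c a} x f.

Section Syzygy.
Variables (R : pzRingType) (C : category) (F : functor R C).

Definition elements (a : C) : Type := F a.

Definition cover : nat_trans (free R elements) F :=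
  @free_map R C elements F (fun a x => x).

Lemma cover_surj a y : exists x, cover a x = y.
Proof. by exists (free_in R (y : elements a) (idm a) 1); rewrite free_mapE fmap1. Qed.

Definition syz_obj a : lmodType R := submod (ker (cover a)).

Lemma syz_fmap_subproof a b (f : hom a b) (z : syz_obj a) :
  fmap (free R elements) f (submod_val z) \in ker (cover b).
Proof.
by apply/kerP; rewrite nt_natural (kerP _ _ (submod_valP z)) linear0.
Qed.

Definition syz_fmap_fun a b (f : hom a b) (z : syz_obj a) : syz_obj b :=
  Submod (syz_fmap_subproof f z).

Lemma syz_fmap_linear a b (f : hom a b) : linear (syz_fmap_fun f).
Proof. by move=> r x y; apply: val_inj; rewrite /= linearP. Qed.

HB.instance Definition _ a b (f : hom a b) := GRing.isLinear.Build R
  (syz_obj a) (syz_obj b) _ (syz_fmap_fun f) (syz_fmap_linear f).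

Definition syz_fmap a b (f : hom a b) : {linear syz_obj a -> syz_obj b} :=
  syz_fmap_fun f.

Lemma syz_fmap1 a z : syz_fmap (idm a) z = z.
Proof. by apply: val_inj; exact: fmap1. Qed.

Lemma syz_fmapM a b c (g : hom b c) (f : hom a b) z :
  syz_fmap (compm g f) z = syz_fmap g (syz_fmap f z).
Proof. by apply: val_inj; exact: fmapM. Qed.

Definition syz : functor R C := Functor syz_fmap1 syz_fmapM.

Definition syz_in_fun a (z : syz a) : free R elements a := submod_val z.

Lemma syz_in_linear a : linear (@syz_in_fun a).
Proof. by []. Qed.

HB.instance Definition _ a := GRing.isLinear.Build R
  (syz a) (free R elements a) _ (@syz_in_fun a) (@syz_in_linear a).

End Syzygy.

Section FreeResolution.
Variables (R : pzRingType) (C : category) (F : functor R C).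

Fixpoint syzygy n : functor R C := if n is m.+1 then syz (syzygy m) else F.

Definition free_res n : functor R C := free R (elements (syzygy n)).

Definition free_res_d_fun n a : {linear free_res n.+1 a -> free_res n a} :=
  @syz_in_fun R C (syzygy n) a \o cover (syzygy n.+1) a.

Lemma free_res_d_natural n a b (f : hom a b) x :
  free_res_d_fun n b (fmap (free_res n.+1) f x) =
  fmap (free_res n) f (free_res_d_fun n a x).
Proof.
exact: (congr1 (@syz_in_fun R C (syzygy n) b)
  (nt_natural (cover (syzygy n.+1)) f x)).
Qed.

Definition free_res_d n : nat_trans (free_res n.+1) (free_res n) :=
  NatTrans (@free_res_d_natural n).

Lemma im_free_res_d n a : im (free_res_d n a) =i ker (cover (syzygy n) a).
Proof.
move=> y; apply/imP/idP => [[x <-]|ky]; first exact: submod_valP.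
have [x xE] := cover_surj (Submod ky : syzygy n.+1 a).
by exists x; exact: (congr1 (@syz_in_fun R C (syzygy n) a) xE).
Qed.

Lemma free_res_exact n : exact_at (free_res_d n.+1) (free_res_d n).
Proof.
move=> a y; rewrite im_free_res_d; apply/kerP/kerP => [y0|y0].
  exact: (congr1 (@syz_in_fun R C (syzygy n) a) y0).
by apply: val_inj; exact: y0.
Qed.

Definition free_resolution : proj_resolution F :=
  @ProjResolution R C F free_res free_res_d (cover F)
    (fun n => @free_projective R C (elements (syzygy n))) free_res_exact
    (@im_free_res_d 0) (surj_epi (@cover_surj R C F)).

End FreeResolution.

Section Colimit.
Variables (R : pzRingType) (C : category).

Section Object.
Variable F : functor R C.

(* colim F is the direct sum of the F a modulo the identification of x : F a
   with its images under all F f. *)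
Definition colim_gen : set (dsum F) :=
  [set z | exists a b (f : hom a b) (x : F a),
    z = dsum_in F b (fmap F f x) - dsum_in F a x].

Definition colim_rel : submodClosed (dsum F) := span colim_gen.

Definition colim : lmodType R := quot colim_rel.

Definition colim_in a : {linear F a -> colim} :=
  @quot_pi _ _ colim_rel \o dsum_in F a.

Lemma colim_in_natural a b (f : hom a b) (x : F a) :
  colim_in b (fmap F f x) = colim_in a x.
Proof.
apply/eqP; rewrite -subr_eq0 /= -raddfB quot_pi_eq0.
by apply: span_gen; exists a, b, f, x.
Qed.

Section Universal.
Variables (N : lmodType R) (h : forall a, {linear F a -> N}).
Hypothesis hnat : forall a b (f : hom a b) x, h b (fmap F f x) = h a x.

Lemma colim_lift_subproof z : z \in colim_rel -> dsum_rec h z = 0.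
Proof.
move=> /asboolP/(_ (ker (dsum_rec h))) hz.
apply/kerP; apply: hz => _ [a [b [f [x ->]]]] /=.
by apply/kerP; rewrite linearB !dsum_recE hnat subrr.
Qed.

Definition colim_lift : {linear colim -> N} :=
  quot_lift (dsum_rec h) colim_lift_subproof.

Lemma colim_liftE a x : colim_lift (colim_in a x) = h a x.
Proof. by rewrite /colim_lift quot_liftE dsum_recE. Qed.

End Universal.

Lemma colim_ext (N : lmodType R) (f g : {linear colim -> N}) :
  (forall a x, f (colim_in a x) = g (colim_in a x)) -> f =1 g.
Proof.
move=> fg; elim/quotW => z.
exact: (@dsum_ext _ _ _ _ (f \o @quot_pi _ _ colim_rel)
  (g \o @quot_pi _ _ colim_rel) fg z).
Qed.

End Object.

Section Map.
Variables (F G : functor R C) (e : nat_trans F G).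

Lemma colim_map_subproof a b (f : hom a b) x :
  (colim_in G b \o e b) (fmap F f x) = (colim_in G a \o e a) x.
Proof. by rewrite /= nt_natural; exact: colim_in_natural. Qed.

Definition colim_map : {linear colim F -> colim G} :=
  colim_lift colim_map_subproof.

End Map.
End Colimit.

Section Homology.
Variables (R : pzRingType) (K : nat -> lmodType R).
Variable d : forall n, {linear K n.+1 -> K n}.

(* The differential out of degree 0 is zero. *)
Definition cycles n : submodClosed (K n) :=
  match n with
  | 0 => ker (\0 : {linear K 0 -> K 0})
  | m.+1 => ker (d m)
  end.

Definition boundaries_pred n : pred (submod (cycles n)) :=
  fun z => submod_val z \in im (d n).

Lemma boundaries_closed n : GRing.subsemimod_closed (@boundaries_pred n).
Proof.
split; first split.
- exact: (rpred0 (im (d n))).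
- by move=> x y xb yb; exact: (rpredD xb yb).
- by move=> a x xb; exact: (rpredZ a xb).
Qed.

Definition boundaries n : submodClosed (submod (cycles n)) :=
  HB.pack_for (submodClosed (submod (cycles n))) (@boundaries_pred n)
    (GRing.isSubmodClosed.Build R _ (@boundaries_pred n) (@boundaries_closed n)).

Definition homology n : lmodType R := quot (boundaries n).

End Homology.

(* The value at F of the n-th left derived functor of colim, computed from a
   projective resolution P of F: up to isomorphism it does not depend on P, and
   free_resolution provides a P for every F. *)
Definition derived_colim (R : pzRingType) (C : category) (F : functor R C)
    (P : proj_resolution F) (n : nat) : lmodType R :=
  homology (fun k => colim_map (res_d P k)) n.

Record digraph := Digraph {
  arrow : Type;
  vertex : Type;
  source : arrow -> vertex;
  target : arrow -> vertex }.

Arguments source {d}.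
Arguments target {d}.

Record representation (R : pzRingType) (Gamma : digraph) := Representation {
  rep_mod :> vertex Gamma -> lmodType R;
  rep_map : forall alpha : arrow Gamma,
    {linear rep_mod (source alpha) -> rep_mod (target alpha)} }.

Section Paths.
Variable Gamma : digraph.

(* [path_cons alpha p] is the word with first letter alpha, so that alpha is
   the last arrow traversed. *)
Inductive gpath (u : vertex Gamma) : vertex Gamma -> Type :=
| path_nil : gpath u u
| path_cons (alpha : arrow Gamma) :
    gpath u (source alpha) -> gpath u (target alpha).

Fixpoint path_cat u v w (q : gpath v w) (p : gpath u v) : gpath u w :=
  match q with
  | path_nil => p
  | path_cons alpha q' => path_cons (path_cat q' p)
  end.

Lemma path_catp1 u v (p : gpath u v) : path_cat p (path_nil u) = p.
Proof. by elim: p => //= alpha p ->. Qed.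

Lemma path_catA u v w z (r : gpath w z) (q : gpath v w) (p : gpath u v) :
  path_cat r (path_cat q p) = path_cat (path_cat r q) p.
Proof. by elim: r => //= alpha r ->. Qed.

Definition path_category : category :=
  @Category (vertex Gamma) gpath path_nil path_cat
    (fun _ _ _ => erefl) path_catp1 path_catA.

Variables (R : pzRingType) (F : representation R Gamma).

Fixpoint path_map u v (p : gpath u v) : {linear F u -> F v} :=
  match p with
  | path_nil => idfun
  | path_cons alpha p' => rep_map F alpha \o path_map p'
  end.

Lemma path_mapM u v w (q : gpath v w) (p : gpath u v) (x : F u) :
  path_map (path_cat q p) x = path_map q (path_map p x).
Proof. by elim: q => //= alpha q ->. Qed.

Definition path_functor : functor R path_category :=
  @Functor R path_category F path_map (fun _ _ => erefl) path_mapM.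

End Paths.

Section Flows.
Variables (R : pzRingType) (Gamma : digraph) (F : representation R Gamma).

(* On the range of each sum, cast_or0 v is the transport along the equality
   source gamma = v, respectively target gamma = v. *)
Definition is_flow : pred (dsum (fun gamma => F (source gamma))) :=
  fun f => `[< forall v : vertex Gamma,
    \sum_(gamma \in [set gamma : {classic arrow Gamma} | source gamma = v])
      cast_or0 v (f gamma) =
    \sum_(gamma \in [set gamma : {classic arrow Gamma} | target gamma = v])
      cast_or0 v (rep_map F gamma (f gamma)) :> F v >].

Lemma is_flow_closed : GRing.subsemimod_closed is_flow.
Proof.
pose M gamma := F (source gamma).
pose I v := @dsum_sum _ _ M (F v) [set gamma : {classic arrow Gamma} | source gamma = v]
  (fun gamma => @cast_or0 _ _ F (source gamma) v : {linear _ -> _}).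
pose O v := @dsum_sum _ _ M (F v) [set gamma : {classic arrow Gamma} | target gamma = v]
  (fun gamma => @cast_or0 _ _ F (target gamma) v \o rep_map F gamma : {linear _ -> _}).
have E f : (f \in is_flow) = `[< forall v, I v f = O v f >] by [].
split; first split.
- by rewrite E; apply/asboolP => v; rewrite /I /O !linear0.
- move=> x y; rewrite !E => /asboolP xf /asboolP yf; apply/asboolP => v.
  by rewrite /I /O [LHS]linearD [RHS]linearD; congr (_ + _); [exact: xf | exact: yf].
- move=> a x; rewrite !E => /asboolP xf; apply/asboolP => v.
  by rewrite /I /O [LHS]linearZ_LR [RHS]linearZ_LR; congr (_ *: _); exact: xf.
Qed.

Definition flow_submod : submodClosed (dsum (fun gamma => F (source gamma))) :=
  HB.pack_for (submodClosed (dsum (fun gamma => F (source gamma))))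
    is_flow (GRing.isSubmodClosed.Build R _ is_flow is_flow_closed).

Definition flows : lmodType R := submod flow_submod.

End Flows.

(* Main.v *)
Require Import Defs.
From mathcomp Require Import all_boot all_algebra.
From HB Require Import structures.
From mathcomp Require Import finmap boolp classical_sets cardinality.

(* For a functor G on the path category let D_G send x in the summand G (s alpha)
   to G(alpha)(x) - x, from the sum of the G (s alpha) over all arrows to the sum
   of the G v over all vertices. Its cokernel is colim G, its kernel at F is the
   module of flows, and D_G is injective when G is projective: a projective is a
   retract of a free functor, and for a free functor a left inverse of D_G sends
   a generator carried by the path alpha_1 ... alpha_n to the sum over i of the
   generator carried by alpha_(i+1) ... alpha_n, in the summand of alpha_i.
   Both sums are exact in G, so the snake relation (lift a flow f to a over P_0,
   then write D a as the image of some v over P_1) is a linear bijection between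
   flows and H_1 (colim P). *)

Set Implicit Arguments.
Unset Strict Implicit.
Unset Printing Implicit Defensive.

Import GRing.Theory.
Import Defs.
Local Open Scope classical_set_scope.
Local Open Scope ring_scope.

(** * Isomorphisms from linear relations *)

(** By linearity the relation is closed under differences, so the two conditions at 0 make it
    single-valued and injective; choice then gives the map and its inverse. *)
Lemma linear_bij_of_rel (R : pzRingType) (M N : lmodType R)
    (T : M -> N -> Prop) :
    (forall a x y x' y', T x y -> T x' y' -> T (a *: x + x') (a *: y + y')) ->
    (forall x, exists y, T x y) -> (forall y, exists x, T x y) ->
    (forall y, T 0 y -> y = 0) -> (forall x, T x 0 -> x = 0) ->
  exists phi : {linear M -> N}, bijective phi.
Proof.
move=> Tlin Ttot Tsurj T0y Tx0.
have TB x y x' y' : T x y -> T x' y' -> T (x - x') (y - y').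
  move=> Txy Txy'; have := Tlin (-1) _ _ _ _ Txy' Txy.
  by rewrite !scaleN1r addrC [- y' + y]addrC.
have Tfun x y y' : T x y -> T x y' -> y = y'.
  move=> Txy Txy'; apply/eqP; rewrite -subr_eq0; apply/eqP/T0y.
  by rewrite -(subrr x); exact: TB.
have Tinj x x' y : T x y -> T x' y -> x = x'.
  move=> Txy Txy'; apply/eqP; rewrite -subr_eq0; apply/eqP/Tx0.
  by rewrite -(subrr y); exact: TB.
have [f Tf] := choice Ttot; have [g Tg] := choice Tsurj.
have f_lin : linear f by move=> a x y; apply: Tfun (Tf _) _; exact: Tlin.
exists (HB.pack_for {linear M -> N} f (GRing.isLinear.Build R M N _ f f_lin)).
exists g => [x|y] /=; first exact: Tinj (Tg _) (Tf _).
exact: Tfun (Tf _) (Tg _).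
Qed.

(** * Exactness of direct sums of modules *)

Section DirectSumMap.
Variables (R : pzRingType) (I : Type).

Lemma dsum_sum_in (M : I -> lmodType R) (N : lmodType R) (D : set {classic I})
    (f : forall i, {linear M i -> N}) i (y : M i) :
  dsum_sum D f (dsum_in M i y) = if (i : {classic I}) \in D then f i y else 0.
Proof.
rewrite (@dsum_sumE _ _ _ _ _ _ [fset (i : {classic I})]%fset).
  by rewrite big_mkcond big_seq_fset1 /= cast_or0_id.
by move=> j; rewrite inE => /eqP ji; rewrite /= cast_or0_neq//; exact: nesym.
Qed.

Section Map.
Variables (M N : I -> lmodType R) (f : forall i, {linear M i -> N i}).

Lemma dsum_map_finite (x : dsum M) : finite_set [set i | f i (x i) != 0].
Proof.
apply: (sub_finite_set _ (dsum_finite x)) => i /=.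
by apply: contra_neq => ->; rewrite linear0.
Qed.

Definition dsum_map_fun (x : dsum M) : dsum N := Dsum (dsum_map_finite x).

Lemma dsum_map_linear : linear dsum_map_fun.
Proof. by move=> a x y; apply: dsumP => i; rewrite /= linearP. Qed.

HB.instance Definition _ :=
  GRing.isLinear.Build R (dsum M) (dsum N) _ dsum_map_fun dsum_map_linear.

Definition dsum_map : {linear dsum M -> dsum N} := dsum_map_fun.

Lemma dsum_mapE x i : dsum_map x i = f i (x i).
Proof. by []. Qed.

Lemma dsum_map_in i (y : M i) : dsum_map (dsum_in M i y) = dsum_in N i (f i y).
Proof.
apply: dsumP => j; rewrite dsum_mapE /=; have [ij|ij] := pselect (i = j).
  by case: _ / ij; rewrite !cast_or0_id.
by rewrite !cast_or0_neq// linear0.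
Qed.

Lemma dsum_map_lift (x : dsum N) :
  (forall i, exists y, f i y = x i) -> exists y, dsum_map y = x.
Proof.
move=> fx.
(* Choosing 0 as the preimage of 0 keeps the support of the lifted family finite. *)
have ex i : exists y, f i y = x i /\ (x i = 0 -> y = 0).
  have [->|/eqP xi] := eqVneq (x i) 0.
    by exists 0; rewrite linear0.
  by have [y fy] := fx i; exists y; split=> // /xi.
pose y i := projT1 (cid (ex i)).
have yP i : f i (y i) = x i /\ (x i = 0 -> y i = 0)
  by exact: projT2 (cid (ex i)).
have yfin : finite_set [set i | y i != 0].
  apply: (sub_finite_set _ (dsum_finite x)) => i /=.
  by apply: contra_neq; exact: (yP i).2.
by exists (Dsum yfin); apply: dsumP => i; exact: (yP i).1.
Qed.

End Map.

Lemma dsum_map_exact (L M N : I -> lmodType R)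
    (f : forall i, {linear L i -> M i}) (g : forall i, {linear M i -> N i}) :
    (forall i, im (f i) =i ker (g i)) ->
  forall x, dsum_map g x = 0 <-> exists y, dsum_map f y = x.
Proof.
move=> fg x; split=> [gx|[y <-]].
  apply: dsum_map_lift => i; apply/imP; rewrite fg; apply/kerP.
  by rewrite -dsum_mapE gx.
apply: dsumP => i; apply/kerP; rewrite -fg; apply/imP; by exists (y i).
Qed.

End DirectSumMap.

(** * The map D_G, here [bdry G], and its cokernel *)

Section Boundary.
Variables (R : pzRingType) (Gamma : digraph).
Notation pcat := (path_category Gamma).

Definition arrow_path (alpha : arrow Gamma) :
    @hom pcat (source alpha) (target alpha) :=
  path_cons (path_nil (source alpha)).

Definition arrow_sum (G : functor R pcat) : lmodType R :=
  dsum (fun alpha : arrow Gamma => G (source alpha)).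

Definition arrow_in (G : functor R pcat) (alpha : arrow Gamma) :
    {linear G (source alpha) -> arrow_sum G} :=
  dsum_in (fun alpha : arrow Gamma => G (source alpha)) alpha.

Definition arrow_map (G H : functor R pcat) (e : nat_trans G H) :
    {linear arrow_sum G -> arrow_sum H} :=
  dsum_map (fun alpha => e (source alpha)).

Definition vertex_map (G H : functor R pcat) (e : nat_trans G H) :
    {linear dsum G -> dsum H} :=
  dsum_map e.

Definition bdry_in (G : functor R pcat) (alpha : arrow Gamma) :
    {linear G (source alpha) -> dsum G} :=
  dsum_in G (target alpha) \o fmap G (arrow_path alpha)
  \- dsum_in G (source alpha).

Definition bdry (G : functor R pcat) : {linear arrow_sum G -> dsum G} :=
  dsum_rec (bdry_in G).

Lemma arrow_map_exact (F G H : functor R pcat) (f : nat_trans F G)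
    (g : nat_trans G H) :
  exact_at f g -> forall x, arrow_map g x = 0 <-> exists y, arrow_map f y = x.
Proof. by move=> fg x; apply: dsum_map_exact => alpha; exact: fg. Qed.

Lemma vertex_map_exact (F G H : functor R pcat) (f : nat_trans F G)
    (g : nat_trans G H) :
  exact_at f g -> forall x, vertex_map g x = 0 <-> exists y, vertex_map f y = x.
Proof. by move=> fg x; exact: dsum_map_exact. Qed.

Lemma arrow_map_surj (G H : functor R pcat) (e : nat_trans G H) :
  epi e -> forall x, exists y, arrow_map e y = x.
Proof. by move=> /epi_surj es x; apply: dsum_map_lift => alpha; exact: es. Qed.

Lemma bdryE (G : functor R pcat) alpha (x : G (source alpha)) :
  bdry G (arrow_in G alpha x) =
  dsum_in G (target alpha) (fmap G (arrow_path alpha) x)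
  - dsum_in G (source alpha) x.
Proof. exact: dsum_recE. Qed.

Lemma bdry_natural (G H : functor R pcat) (e : nat_trans G H) x :
  bdry H (arrow_map e x) = vertex_map e (bdry G x).
Proof.
apply: (@dsum_ext _ _ _ _ (bdry H \o arrow_map e) (vertex_map e \o bdry G)).
move=> alpha y.
rewrite -[LHS]/(bdry H (arrow_map e (arrow_in G alpha y))).
rewrite -[RHS]/(vertex_map e (bdry G (arrow_in G alpha y))).
by rewrite [arrow_map e _]dsum_map_in !bdryE linearB /= !dsum_map_in nt_natural.
Qed.

(** Relations telescope: the one for x and the path alpha p is the one for x and p, plus D_G of the
    image of x under p placed in the summand of alpha. *)
Lemma colim_rel_bdry (G : functor R pcat) : colim_rel G =i im (bdry G).
Proof.
move=> z; apply/idP/imP => [/asboolP zS|[x <-]].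
  apply/imP; apply: zS => _ [u [v [p [x ->]]]].
  change (dsum_in G v (fmap G p x) - dsum_in G u x \in im (bdry G)).
  elim: p => [|alpha p IHp].
    by rewrite -[path_nil u]/(@idm pcat u) fmap1 subrr rpred0.
  rewrite -[path_cons p]/(@compm pcat _ _ _ (arrow_path alpha) p) fmapM.
  rewrite -(subrK (dsum_in G (source alpha) (fmap G p x)) (dsum_in G _ _)).
  rewrite -addrA rpredD//; apply/imP; exists (arrow_in G alpha (fmap G p x)).
  exact: bdryE.
rewrite -quot_pi_eq0; apply/eqP.
apply: (@dsum_ext _ _ _ _ (@quot_pi _ _ (colim_rel G) \o bdry G) \0).
move=> alpha y; apply/eqP.
rewrite -[_ == _]/(quot_pi _ (bdry G (arrow_in G alpha y)) == 0).
rewrite bdryE quot_pi_eq0.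
by apply: span_gen; exists (source alpha), (target alpha), (arrow_path alpha), y.
Qed.

Lemma colim_map_pi (G H : functor R pcat) (e : nat_trans G H) (x : dsum G) :
  colim_map e (quot_pi (colim_rel G) x) =
  quot_pi (colim_rel H) (vertex_map e x).
Proof.
apply: (@dsum_ext _ _ _ _ (colim_map e \o @quot_pi _ _ (colim_rel G))
  (@quot_pi _ _ (colim_rel H) \o vertex_map e)) => v y /=.
rewrite dsum_map_in; exact: (colim_liftE (colim_map_subproof e) y).
Qed.

(** * Injectivity of D_G for free and projective G *)

Section FreeInjective.
Variable X : pcat -> Type.

Fixpoint path_suffixes u v (x : X u) (p : gpath u v) :
    arrow_sum (free R X) :=
  match p with
  | path_nil => 0
  | path_cons alpha q =>
      arrow_in (free R X) alpha
        (free_in R x (q : @hom pcat u (source alpha)) 1)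
      + path_suffixes x q
  end.

Definition suffixes : {linear dsum (free R X) -> arrow_sum (free R X)} :=
  dsum_rec (fun v => free_rec (fun u x p => @path_suffixes u v x p)).

Lemma suffixesE v u (x : X u) (p : @hom pcat u v) :
  suffixes (dsum_in (free R X) v (free_in R x p 1)) = path_suffixes x p.
Proof. by rewrite /suffixes dsum_recE free_recE scale1r. Qed.

(** D sends the generator carried by p in the summand of alpha to the generator of alpha p minus
    that of p; their suffix sums differ by exactly the original generator. *)
Lemma bdry_freeK : cancel (bdry (free R X)) suffixes.
Proof.
apply: (@dsum_ext _ _ _ _ (suffixes \o bdry (free R X)) idfun) => alpha.
apply: (@free_ext _ _ _ _ _
  (suffixes \o bdry (free R X) \o arrow_in (free R X) alpha)
  (arrow_in (free R X) alpha)) => u x p.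
rewrite -[LHS]/(suffixes (bdry _ (arrow_in (free R X) alpha (free_in R x p 1)))).
rewrite bdryE [LHS]linearB.
have -> : fmap (free R X) (arrow_path alpha) (free_in R x p 1) =
    free_in R x (compm (arrow_path alpha) p) 1 by exact: free_fmapE.
rewrite !suffixesE; exact: addrK.
Qed.

End FreeInjective.

(** Lifting the identity along [cover G] gives a section s into a free functor. By naturality D
    kills the image of x under s, so this image is 0, and [cover G] maps it back to x. *)
Lemma bdry_projective_eq0 (G : functor R pcat) (x : arrow_sum G) :
  projective G -> bdry G x = 0 -> x = 0.
Proof.
move=> Gproj dx.
have id_nat a b (f : @hom pcat a b) (y : G a) :
  (idfun : {linear G b -> G b}) (fmap G f y) =
  fmap G f ((idfun : {linear G a -> G a}) y) by [].
have [s sK] := Gproj _ _ (cover G)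
  (@NatTrans R pcat G G (fun a => idfun) id_nat) (surj_epi (@cover_surj _ _ G)).
have: arrow_map s x = 0.
  by rewrite -[LHS]bdry_freeK bdry_natural dx !linear0.
move=> /(congr1 (arrow_map (cover G))); rewrite linear0 => <-.
by apply: dsumP => alpha; rewrite !dsum_mapE sK.
Qed.

(** * Flows as the kernel of D *)

Lemma is_flow_bdry (F : representation R Gamma)
    (f : arrow_sum (path_functor F)) :
  reflect (bdry (path_functor F) f = 0) (f \in flow_submod F).
Proof.
pose M gamma := F (source gamma).
pose I v := @dsum_sum _ _ M (F v)
  [set gamma : {classic arrow Gamma} | source gamma = v]
  (fun gamma => @cast_or0 _ _ F (source gamma) v : {linear _ -> _}).
pose O v := @dsum_sum _ _ M (F v)
  [set gamma : {classic arrow Gamma} | target gamma = v]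
  (fun gamma => @cast_or0 _ _ F (target gamma) v \o rep_map F gamma
    : {linear _ -> _}).
(* The coordinate of D at v is inflow minus outflow: [O v] runs over the arrows ending at v, [I v]
   over those starting there. *)
have dE g v : bdry (path_functor F) g v = O v g - I v g.
  apply: (@dsum_ext _ _ _ _
    (@dsum_proj _ _ (path_functor F) v \o bdry (path_functor F))
    (O v \- I v : {linear dsum M -> F v})) => alpha y.
  rewrite -[LHS]/(bdry (path_functor F) (arrow_in (path_functor F) alpha y) v).
  rewrite -[RHS]/(O v (dsum_in M alpha y) - I v (dsum_in M alpha y)).
  rewrite bdryE /O /I !dsum_sum_in /dsum_proj /=.
  (* For an arrow outside the index set, [cast_or0] takes its default value 0. *)
  congr (_ - _); case: ifPn => //; rewrite notin_setE => /= ne;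
    exact: cast_or0_neq.
apply: (iffP (asboolP _)) => [fl|d0 v].
  by apply: dsumP => v; rewrite dE [I v f]fl subrr.
by apply/esym/eqP; rewrite -subr_eq0; have := dE f v; rewrite d0 => <-.
Qed.

End Boundary.

(** * The snake relation between flows and first homology *)

Theorem theorem2p4 (R : pzRingType) (Gamma : digraph)
    (F : representation R Gamma) (P : proj_resolution (path_functor F)) :
  exists phi : {linear flows F -> derived_colim P 1}, bijective phi.
Proof.
have proj0 := @res_projective _ _ _ P 0; have ex1 := @res_exact _ _ _ P 0.
have ex0 := @res_exact0 _ _ _ P; have augS := @res_epi _ _ _ P.
pose pi n := @quot_pi _ _ (colim_rel (P n)).
pose d n := colim_map (res_d P n).
pose del n := vertex_map (res_d P n).
pose adel n := arrow_map (res_d P n).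
pose eps := arrow_map (res_aug P).
have piP n z : reflect (exists x, bdry (P n) x = z) (pi n z == 0).
  by rewrite /pi quot_pi_eq0 colim_rel_bdry; exact: imP.
have piB n : {morph pi n : x y / x - y} by exact: linearB.
have pi_del n v : pi n (del n v) = d n (pi n.+1 v) by rewrite /d colim_map_pi.
(* The lifts [a] and [v] stay existential; [z] is the class of [v] in the colimit, packaged as a
   cycle. *)
pose T (f : flows F) (h : derived_colim P 1) :=
  exists (a : arrow_sum (P 0)) (v : dsum (P 1)) (z : submod (cycles d 1)),
  [/\ eps a = submod_val f, bdry (P 0) a = del 0 v,
      submod_val z = pi 1 v & h = quot_pi (boundaries d 1) z].
apply: (@linear_bij_of_rel _ _ _ T).
- move=> r f h f' h' [a [v [z [af av zv ->]]]] [a' [v' [z' [af' av' zv' ->]]]].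
  exists (r *: a + a'), (r *: v + v'), (r *: z + z'); split.
  + by rewrite linearP af af'.
  + by rewrite !linearP av av'.
  + by rewrite /pi linearP [LHS]/= zv zv'.
  + by rewrite linearP.
(* Totality: D a dies over F because f is a flow, so it lifts to v; the class of v is a cycle since
   D a vanishes in the colimit. *)
- move=> f; have [a af] := arrow_map_surj augS (submod_val f).
  have /(vertex_map_exact ex0)[v va] :
      vertex_map (res_aug P) (bdry (P 0) a) = 0.
    by rewrite -bdry_natural af; apply/is_flow_bdry/submod_valP.
  have zP : pi 1 v \in cycles d 1.
    apply/kerP; rewrite -pi_del /del va; apply/eqP/piP; by exists a.
  by exists (quot_pi (boundaries d 1) (Submod zP)), a, v, (Submod zP).
(* Surjectivity runs the snake backwards: for a cycle, [del 0 v] is some D a, and [eps a] is a flow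
   because the augmentation kills [del 0 v]. *)
- elim/quotW => -[q qP]; elim/quotW: q => v in qP *.
  have /eqP/piP[a av] : pi 0 (del 0 v) = 0 by rewrite pi_del; apply/kerP.
  have fP : eps a \in flow_submod F.
    apply/is_flow_bdry; rewrite bdry_natural av.
    by apply/(vertex_map_exact ex0); exists v.
  by exists (Submod fP), a, v, (Submod qP).
(* If f = 0, then a comes from b, and v - D b from some w over P_2; D b is 0 in the colimit, so z
   bounds the class of w. *)
- move=> h [a [v [z [a0 av zv ->]]]].
  have /(arrow_map_exact ex0)[b ba] := a0.
  have /(vertex_map_exact ex1)[w wv] :
      del 0 (v - bdry (P 1) b) = 0.
    by rewrite linearB /= -bdry_natural ba av subrr.
  apply/eqP; rewrite quot_pi_eq0; apply/imP; exists (pi 2 w).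
  rewrite -[LHS]pi_del zv /del wv piB.
  have /piP/eqP -> : exists x, bdry (P 1) x = bdry (P 1) b by exists b.
  exact: subr0.
(* If h = 0, then v = [del 1 w] + D b for some w and b. So a and [adel 0 b] have equal images under
   D, which is injective at the projective P_0; hence f = [eps a] is 0. *)
- move=> f [a [v [z [af av zv /esym/eqP]]]].
  rewrite quot_pi_eq0 => /imP[q]; elim/quotW: q => w.
  rewrite zv -[LHS]pi_del => dw.
  have /eqP/piP[b bv] : pi 1 (v - del 1 w) = 0 by rewrite piB -dw subrr.
  have a0 : a = adel 0 b.
    apply/eqP; rewrite -subr_eq0; apply/eqP.
    apply: bdry_projective_eq0 proj0 _.
    have dd : del 0 (del 1 w) = 0.
      by apply/(vertex_map_exact ex1); exists w.
    rewrite linearB /= bdry_natural bv linearB [vertex_map _ (del 1 w)]dd.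
    by rewrite subr0 av subrr.
  apply: val_inj; rewrite /= -af a0.
  by apply/(arrow_map_exact ex0); exists b.
Qed.
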